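(* Let $f:\{0,1\}^r\to\{0,1\}$ be the dictator $f(x)=x_j$ for a fixed $j\in[r]$, and let $N\ge 2$. Then for every $s\in\{1,\dots,N-1\}$, $$\mathbb{E}[T\mid S_0=s]=N(N-s)\bigl(H_{N-1}-H_{N-s-1}\bigr)+Ns\bigl(H_{N-1}-H_s\bigr).$$
   Context: Consider the discrete-time Markov chain $X^{(t)}\in\{0,1\}^N$ whose step is: draw $V$ uniform on $[N]=\{1,\dots,N\}$; draw $J_1,\dots,J_r$ i.i.d. uniform on $[N]$, independent of $V$ (all fresh at each step); set $X^{(t+1)}_V=f(X^{(t)}_{J_1},\dots,X^{(t)}_{J_r})$ and leave every other coordinate unchanged. $T=\inf\{t: X^{(t)}\text{ is constant}\}$ and $S_t=\#\{i:X_i^{(t)}=1\}$, itself a Markov chain. Harmonic numbers: $H_n=\sum_{l=1}^n 1/l$ for $n\ge1$, $H_0=0$. *)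

(* Defs.v *)
From HB Require Import structures.
From mathcomp Require Export all_boot all_order all_algebra.
From mathcomp Require Export all_classical all_reals all_analysis.

Set Implicit Arguments.
Unset Strict Implicit.
Unset Printing Implicit Defensive.

Import Order.TTheory GRing.Theory Num.Theory.

Local Open Scope classical_set_scope.
Local Open Scope ring_scope.

Definition discrete_measurable_fun d (Omega : measurableType d) (E : Type)
    (Y : Omega -> E) : Prop :=
  forall B : set E, measurable (Y @^-1` B).

Definition preimage_events (Omega E : Type) (Y : Omega -> E) :
    set (set Omega) :=
  [set Y @^-1` B | B in [set: set E]].

Definition mutually_independent d (Omega : measurableType d) (R : realType)
    (P : probability Omega R) (I : eqType) (G : I -> set (set Omega)) : Prop :=
  forall (s : seq I) (A : I -> set Omega), uniq s ->
    (forall i, i \in s -> G i (A i)) ->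
    P (\bigcap_(i in [set` s]) A i) = (\prod_(i <- s) P (A i))%E.

Definition uniformly_distributed d (Omega : measurableType d) (R : realType)
    (P : probability Omega R) (N : nat) (Y : Omega -> 'I_N) : Prop :=
  forall v : 'I_N, P (Y @^-1` [set v]) = (N%:R^-1)%:E.

Definition cond_expectation d (Omega : measurableType d) (R : realType)
    (P : probability Omega R) (Y : Omega -> \bar R) (A : set Omega) : \bar R :=
  ((\int[P]_(w in A) Y w) / P A)%E.

Definition state (N : nat) : Type := {ffun 'I_N -> bool}.

Definition update (N r : nat) (f : {ffun 'I_r -> bool} -> bool) (x : state N)
    (v : 'I_N) (js : 'I_r -> 'I_N) : state N :=
  [ffun i => if i == v then f [ffun k => x (js k)] else x i].

(* The sources of randomness: [None] is the initial state, [Some (t, None)] the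
   updated site at step [t], [Some (t, Some k)] its [k]-th sample. *)
Definition source_events (Omega : Type) (N r : nat) (X0 : Omega -> state N)
    (V : nat -> Omega -> 'I_N) (J : nat -> 'I_r -> Omega -> 'I_N)
    (a : option (nat * option 'I_r)) : set (set Omega) :=
  match a with
  | None => preimage_events X0
  | Some (t, None) => preimage_events (V t)
  | Some (t, Some k) => preimage_events (J t k)
  end.

(* The initial law is arbitrary. *)
Record update_chain d (Omega : measurableType d) (R : realType)
    (P : probability Omega R) (N r : nat) (f : {ffun 'I_r -> bool} -> bool)
    (X : nat -> Omega -> state N) (V : nat -> Omega -> 'I_N)
    (J : nat -> 'I_r -> Omega -> 'I_N) : Prop := UpdateChain {
  update_chain_measurable_init : discrete_measurable_fun (X 0%N);
  update_chain_measurable_site : forall t, discrete_measurable_fun (V t);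
  update_chain_measurable_sample : forall t k, discrete_measurable_fun (J t k);
  update_chain_uniform_site : forall t, uniformly_distributed P (V t);
  update_chain_uniform_sample : forall t k, uniformly_distributed P (J t k);
  update_chain_independent : mutually_independent P (source_events (X 0%N) V J);
  update_chain_step : forall t w,
    X t.+1 w = update f (X t w) (V t w) (fun k => J t k w) }.

Definition constant_state (N : nat) (x : state N) : Prop :=
  forall i i' : 'I_N, x i = x i'.

Definition num_ones (N : nat) (x : state N) : nat := #|[pred i | x i]|.

(* The infimum is [+oo] on trajectories that never become constant. *)
Definition consensus_time (Omega : Type) (R : realType) (N : nat)
    (X : nat -> Omega -> state N) (w : Omega) : \bar R :=
  ereal_inf [set t%:R%:E | t in [set t : nat | constant_state (X t w)]].

Definition dictator (r : nat) (j : 'I_r) (x : {ffun 'I_r -> bool}) : bool := x j.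

Definition harmonic_number (R : realType) (n : nat) : R :=
  \sum_(1 <= l < n.+1) l%:R^-1.

(* Main.v *)
Require Import Defs.
From mathcomp Require Import all_boot all_order all_algebra.
From mathcomp Require Import all_classical all_reals all_analysis.
From mathcomp Require Import ring zify.

Set Implicit Arguments.
Unset Strict Implicit.
Unset Printing Implicit Defensive.

Import Order.TTheory GRing.Theory Num.Theory.
Import numFieldNormedType.Exports.

Local Open Scope classical_set_scope.
Local Open Scope ring_scope.

(** Under the dictator rule the updated site copies one uniformly chosen site, so
    this is the voter model on the complete graph: if [s] of the [N] coordinates
    are ones, the number of ones moves to [s - 1] or to [s + 1], each with
    probability [s (N - s) / N ^ 2], and it is absorbed at [0] and [N].

    Let [K] be the transition operator on functions of the state, [b] the indicator
    of the nonconstant states and [h x] the claimed mean as a function of the number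
    of ones of [x], extended by [0] to the constant states.  It solves the Poisson
    equation [K h = h - b] ([poisson_equation]).  Telescoping gives
    [sum_(k < n) K^k b = h - K^n h].  Since [h] is bounded and vanishes where [b]
    does, [|h| <= C b], hence [|K^n h| <= C K^n b].  The partial sums are therefore
    bounded, so [K^n b] tends to [0], so does [K^n h], and
    [sum_n K^n b = h] ([survival_series]).

    On the probabilistic side, [T = sum_t 1{X_t nonconstant}] because constant
    states are absorbing ([consensus_time_series]), and
    [P(X_0 = x, X_t nonconstant) = P(X_0 = x) (K^t b)(x)].  The latter is the Markov
    property ([markov_property]): it follows from the independence and uniformity
    of the choices by conditioning on all the choices made so far, of which there
    are finitely many.  Summing over [t] and over the initial states with [s] ones
    gives the theorem. *)

(** * The closed form and its second difference *)

Lemma harmonic_numberS (R : realType) (n : nat) :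
  harmonic_number R n.+1 = harmonic_number R n + n.+1%:R^-1.
Proof. by rewrite /harmonic_number big_nat_recr. Qed.

(** The closed form splits into [a s] and [a (N - s)] with [a] this function, whose
    second difference at [s] is [- 1 / s]. *)
Definition harmonic_gap (R : realType) (N s : nat) : R :=
  s%:R * (harmonic_number R (N - 1) - harmonic_number R s).

Lemma harmonic_gap0 (R : realType) (N : nat) : harmonic_gap R N 0 = 0.
Proof. by rewrite /harmonic_gap mul0r. Qed.

Lemma harmonic_gap_full (R : realType) (N : nat) :
  (0 < N)%N -> harmonic_gap R N N = - 1.
Proof.
case: N => // n _; rewrite /harmonic_gap subn1 /= harmonic_numberS opprD.
by rewrite addrA subrr add0r mulrN mulfV ?pnatr_eq0.
Qed.

Lemma harmonic_gap_second_difference (R : realType) (N s : nat) :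
  (0 < s)%N ->
  harmonic_gap R N s.+1 + harmonic_gap R N s.-1 - 2 * harmonic_gap R N s
    = - s%:R^-1.
Proof.
case: s => // s _; rewrite /harmonic_gap /= !harmonic_numberS -!(natr1 s).
rewrite -(natr1 s.+1) -(natr1 s).
have s1 : s%:R + 1 != 0 :> R by rewrite natr1 pnatr_eq0.
have s2 : s%:R + 1 + 1 != 0 :> R by rewrite !natr1 pnatr_eq0.
by field; rewrite s1 s2.
Qed.

(** A form of the mean that is symmetric in [s] and [N - s].  It agrees with the
    stated one for [0 < s < N], and it vanishes at [0] and at [N], whereas the
    stated one takes the value [- N] at [N]. *)
Definition mean_consensus_time (R : realType) (N s : nat) : R :=
  N%:R * (1 + harmonic_gap R N s + harmonic_gap R N (N - s)).

Lemma mean_consensus_time_constant (R : realType) (N s : nat) :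
  (0 < N)%N -> ~~ (0 < s < N)%N -> (s <= N)%N -> mean_consensus_time R N s = 0.
Proof.
move=> N0 sN lesN; rewrite /mean_consensus_time.
have [->|->] : s = 0%N \/ s = N by lia.
  by rewrite subn0 harmonic_gap0 harmonic_gap_full//; ring.
by rewrite subnn harmonic_gap0 harmonic_gap_full//; ring.
Qed.

Lemma mean_consensus_time_interior (R : realType) (N s : nat) :
  (0 < s < N)%N ->
  mean_consensus_time R N s =
  N%:R * (N%:R - s%:R)
     * (harmonic_number R (N - 1) - harmonic_number R (N - s - 1))
  + N%:R * s%:R * (harmonic_number R (N - 1) - harmonic_number R s).
Proof.
move=> sN; rewrite /mean_consensus_time /harmonic_gap.
have [m mE] : exists m, (N - s = m.+1)%N by exists (N - s).-1; lia.
have -> : N%:R - s%:R = m.+1%:R :> R by rewrite -natrB ?mE//; lia.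
(* [H_(N-s)] exceeds [H_(N-s-1)] by [1 / (N - s)]: times [N - s], this is the
   summand [1] of [mean_consensus_time]. *)
rewrite mE subSS subn0 harmonic_numberS -(natr1 m).
have m1 : m%:R + 1 != 0 :> R by rewrite natr1 pnatr_eq0.
by field.
Qed.

Lemma mean_consensus_time_second_difference (R : realType) (N s : nat) :
  (0 < s < N)%N ->
  s%:R * (N - s)%:R
    * (mean_consensus_time R N s.+1 + mean_consensus_time R N s.-1
       - 2 * mean_consensus_time R N s)
  = - N%:R ^+ 2.
Proof.
move=> sN; rewrite /mean_consensus_time.
have -> : (N - s.+1 = (N - s).-1)%N by lia.
have -> : (N - s.-1 = (N - s).+1)%N by lia.
have /(harmonic_gap_second_difference R N) ds : (0 < s)%N by lia.
have /(harmonic_gap_second_difference R N) dNs : (0 < N - s)%N by lia.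
have s0 : s%:R != 0 :> R by rewrite pnatr_eq0; lia.
have Ns0 : (N - s)%:R != 0 :> R by rewrite pnatr_eq0; lia.
set A := (X in _ * X = _).
have -> : A = N%:R * (- s%:R^-1 - (N - s)%:R^-1).
  by rewrite -ds -dNs /A; ring.
have -> : N%:R = s%:R + (N - s)%:R :> R by rewrite -natrD; congr _%:R; lia.
by field; rewrite s0 Ns0.
Qed.

(** * One step of the copying dynamics *)

Definition copy_site (N : nat) (x : state N) (v u : 'I_N) : state N :=
  [ffun i => if i == v then x u else x i].

Definition nonconstant (N : nat) (x : state N) : bool :=
  (0 < num_ones x < N)%N.

Lemma num_ones_le (N : nat) (x : state N) : (num_ones x <= N)%N.
Proof. by rewrite -[leqRHS]card_ord max_card. Qed.

Lemma constant_stateP (N : nat) (x : state N) :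
  constant_state x <-> ~~ nonconstant x.
Proof.
split=> [cx|].
  apply/negP => /andP[/card_gt0P[i xi]]; rewrite ltnNge => /negP; apply.
  rewrite -[leqLHS]card_ord; apply/subset_leq_card/fintype.subsetP => k _.
  by rewrite !inE (cx k i).
move=> nx i i'; have := num_ones_le x.
have [/card0_eq x0 _|x0] := eqVneq (num_ones x) 0%N.
  by have := x0 i; have := x0 i'; rewrite !inE => -> ->.
move=> lexN; have xN : num_ones x = N by move: nx; rewrite /nonconstant; lia.
have : [pred i | x i] =i predT.
  by apply/subset_cardP; [rewrite card_ord | apply/subset_predT].
by move=> xT; have := xT i; have := xT i'; rewrite !inE => -> ->.
Qed.

Lemma copy_site_constant (N : nat) (x : state N) (v u : 'I_N) :
  constant_state x -> constant_state (copy_site x v u).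
Proof. by move=> cx i i'; rewrite !ffunE; case: ifP; case: ifP. Qed.

Lemma num_onesE (N : nat) (x : state N) : num_ones x = (\sum_i x i)%N.
Proof.
rewrite /num_ones -sum1_card big_mkcond; apply: eq_bigr => i _.
by rewrite inE; case: (x i).
Qed.

(** Written additively, so that no truncated subtraction occurs. *)
Lemma num_ones_copy_site (N : nat) (x : state N) (v u : 'I_N) :
  (num_ones (copy_site x v u) + x v = num_ones x + x u)%N.
Proof.
rewrite !num_onesE (bigD1 v)//= [in RHS](bigD1 v)//= ffunE eqxx.
rewrite (eq_bigr (fun i => x i : nat)) => [|i /negbTE iv].
  by rewrite addnAC [RHS]addnC addnA.
by rewrite ffunE iv.
Qed.

(** The transition operator of the chain, acting on functions of the state. *)
Definition voter_average (R : realType) (N : nat) (g : state N -> R) :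
    state N -> R :=
  fun x => (\sum_(v : 'I_N) \sum_(u : 'I_N) g (copy_site x v u)) / N%:R ^+ 2.

Lemma voter_averageB (R : realType) (N : nat) (g h : state N -> R) x :
  voter_average (fun y => g y - h y) x = voter_average g x - voter_average h x.
Proof.
rewrite /voter_average -mulrBl -sumrB; congr (_ / _).
by apply: eq_bigr => v _; rewrite -sumrB.
Qed.

(** The number of ones drops when a one copies a zero and grows when a zero copies
    a one; each happens for [s (N - s)] of the [N ^ 2] pairs of sites. *)
Lemma voter_average_num_ones (R : realType) (N : nat) (H : nat -> R)
    (x : state N) :
  let s := num_ones x in (0 < N)%N ->
  voter_average (fun y => H (num_ones y)) x =
  H s + s%:R * (N - s)%:R / N%:R ^+ 2 * (H s.+1 + H s.-1 - 2 * H s).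
Proof.
move=> s N0; rewrite /voter_average.
have N2 : N%:R ^+ 2 != 0 :> R by rewrite sqrf_eq0 pnatr_eq0 -lt0n.
have sum1 : \sum_(i : 'I_N) (x i)%:R = s%:R :> R.
  by rewrite /s num_onesE natr_sum.
have sum0 : \sum_(i : 'I_N) (~~ x i)%:R = (N - s)%:R :> R.
  rewrite natrB ?num_ones_le// -sum1 -[N in N%:R]card_ord -sum1_card natr_sum.
  by rewrite -sumrB; apply: eq_bigr => i _; case: (x i); rewrite ?subrr ?subr0.
have step v u : H (num_ones (copy_site x v u)) =
    H s + (x v)%:R * (~~ x u)%:R * (H s.-1 - H s)
        + (~~ x v)%:R * (x u)%:R * (H s.+1 - H s).
  have := num_ones_copy_site x v u; rewrite -/s.
  case: (x v); case: (x u) => /= e; rewrite ?mulr0n ?mulr1n.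
  - have -> : num_ones (copy_site x v u) = s by lia.
    by ring.
  - have -> : num_ones (copy_site x v u) = s.-1 by lia.
    by ring.
  - have -> : num_ones (copy_site x v u) = s.+1 by lia.
    by ring.
  - have -> : num_ones (copy_site x v u) = s by lia.
    by ring.
under eq_bigr => v _.
  under eq_bigr => u _ do rewrite step.
  rewrite !big_split /= sumr_const card_ord -!mulr_suml -!mulr_sumr sum0 sum1.
  over.
rewrite !big_split /= sumr_const card_ord -!mulr_suml sum0 sum1.
rewrite -(mulr_natr (H s)) -(mulr_natr (H s * _)).
have N1 : N%:R != 0 :> R by rewrite pnatr_eq0 -lt0n.
by field.
Qed.

(** The second difference of the closed form is minus the inverse of the
    probability of a jump up, which is also that of a jump down, so that one step from a nonconstant state costs exactly one unit
    of time; at a constant state the jump probability is zero. *)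
Lemma poisson_equation (R : realType) (N : nat) (x : state N) :
  let h y := mean_consensus_time R N (num_ones y) in (0 < N)%N ->
  voter_average h x = h x - (nonconstant x)%:R.
Proof.
move=> h N0; rewrite /h voter_average_num_ones//.
have N2 : N%:R ^+ 2 != 0 :> R by rewrite sqrf_eq0 pnatr_eq0 -lt0n.
case: (boolP (nonconstant x)) => [nx|cx].
  rewrite mulrAC mean_consensus_time_second_difference//.
  by rewrite mulNr mulfV.
have /orP[/eqP->|/eqP->] : (num_ones x == 0%N) || (num_ones x == N).
- by have := num_ones_le x; move: cx; rewrite /nonconstant; lia.
- by rewrite !mul0r addr0 subr0.
- by rewrite subnn mulr0 !mul0r addr0 subr0.
Qed.

Lemma iter_voter_average1 (R : realType) (N n : nat) (x : state N) :
  (0 < N)%N -> iter n (@voter_average R N) (fun=> 1) x = 1.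
Proof.
move=> N0; elim: n x => // n IHn x /=; rewrite /voter_average.
under eq_bigr do under eq_bigr do rewrite IHn.
rewrite !sumr_const !card_ord -(mulr_natr N%:R) -expr2 mulfV//.
by rewrite sqrf_eq0 pnatr_eq0 -lt0n.
Qed.

(** The transition operator is positive. *)
Lemma iter_voter_average_le (R : realType) (N : nat) (g b : state N -> R)
    (C : R) :
  (forall x, `|g x| <= C * b x) ->
  forall n x, `|iter n (@voter_average R N) g x|
    <= C * iter n (@voter_average R N) b x.
Proof.
move=> gb; elim=> [|n IHn] x /=; first exact: gb.
rewrite /voter_average mulrA normrM [`|_^-1|]ger0_norm ?invr_ge0 ?exprn_ge0//.
rewrite ler_wpM2r ?invr_ge0 ?exprn_ge0// mulr_sumr.
apply: le_trans (ler_norm_sum _ _ _) _; apply: ler_sum => v _.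
rewrite mulr_sumr.
by apply: le_trans (ler_norm_sum _ _ _) _; apply: ler_sum => u _; apply: IHn.
Qed.

(** * Summing the survival probabilities *)

(** By [markov_property] below, this is the probability that the chain started at
    [x] is not yet constant at time [n]. *)
Definition survival (R : realType) (N : nat) : nat -> state N -> R :=
  fun n => iter n (@voter_average R N) (fun y => (nonconstant y)%:R).

Lemma survival_ge0 (R : realType) (N n : nat) (x : state N) :
  0 <= survival R n x.
Proof.
rewrite -[leRHS]mul1r; apply: le_trans (normr_ge0 _) _; last first.
  by apply: iter_voter_average_le => y; rewrite mul1r ger0_norm.
Qed.

(** Telescoping of the Poisson equation along the iterates of the operator. *)
Lemma sum_survival (R : realType) (N n : nat) (x : state N) :
  let h y := mean_consensus_time R N (num_ones y) in (0 < N)%N ->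
  \sum_(0 <= k < n) survival R k x = h x - iter n (@voter_average R N) h x.
Proof.
move=> h N0; elim: n => [|n IHn]; first by rewrite big_nil subrr.
rewrite big_nat_recr//= IHn -addrA; congr (_ + _).
suff -> : forall y, survival R n y =
    iter n (@voter_average R N) h y - iter n.+1 (@voter_average R N) h y.
  by rewrite addrA addNr add0r.
elim: n {IHn} => [|n IHn] y.
  by rewrite /survival /= poisson_equation// opprB addrC subrK.
rewrite /survival iterS -/(survival _ _) (funext IHn).
by rewrite voter_averageB -!iterS.
Qed.

(** The remainder of the telescoped sum is at most a constant times the current
    survival probability, which is at most [1].  This first bounds the partial
    sums, hence forces the survival probabilities to [0], and then forces the
    remainder itself to [0]. *)
Lemma survival_series (R : realType) (N : nat) (x : state N) :
  (0 < N)%N ->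
  series (fun n => survival R n x) @ \oo
    --> mean_consensus_time R N (num_ones x).
Proof.
move=> N0; pose h (y : state N) := mean_consensus_time R N (num_ones y).
pose C := \sum_(s < N.+1) `|mean_consensus_time R N s|.
have hC y : `|h y| <= C * (nonconstant y)%:R.
  rewrite /h; case: (boolP (nonconstant y)) => [_|cy].
    rewrite mulr1 /C.
    have yN : (num_ones y < N.+1)%N by rewrite ltnS num_ones_le.
    by rewrite (bigD1 (Ordinal yN))//= lerDl sumr_ge0.
  by rewrite mean_consensus_time_constant ?num_ones_le// normr0 mulr0.
have Kh n : `|iter n (@voter_average R N) h x| <= C * survival R n x.
  exact: iter_voter_average_le.
have C0 : 0 <= C by apply: sumr_ge0.
have survival0 : survival R n x @[n --> \oo] --> (0 : R).
  apply: cvg_series_cvg_0; apply: nondecreasing_is_cvgn.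
    apply/nondecreasing_seqP => n; rewrite /series /= big_nat_recr//= lerDl.
    exact: survival_ge0.
  exists (h x + C * (1 : R)) => _ [n _ <-]; rewrite /series /= sum_survival//.
  rewrite lerD2l; apply: le_trans (ler_norm _) _; rewrite normrN.
  apply: le_trans (@iter_voter_average_le _ _ _ (fun=> 1) C _ n x) _.
    by move=> y; apply: le_trans (hC y) _; rewrite ler_wpM2l// lern1 leq_b1.
  by rewrite iter_voter_average1.
have -> : series (fun n => survival R n x) =
    (fun n => h x - iter n (@voter_average R N) h x).
  by apply/funext => n; rewrite /series /= sum_survival.
rewrite -[X in _ --> X]subr0; apply: cvgB; first exact: cvg_cst.
apply: norm_cvg0.
apply: (@squeeze_cvgr _ _ _ _ (fun=> 0) (fun n => C * survival R n x)).
- by apply: nearW => n; rewrite normr_ge0 Kh.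
- exact: cvg_cst.
- by rewrite -[X in _ --> X](mulr0 C); apply: cvgMr.
Qed.

(** * Tools from measure theory *)

(** Counts the times before the first failure of a predicate that stays false once
    it fails; both sides are [+oo] if it never fails. *)
Lemma hitting_time_series (R : realType) (b : nat -> bool) :
  (forall t, b t.+1 -> b t) ->
  ereal_inf [set t%:R%:E | t in [set t : nat | ~~ b t]]
  = (\sum_(0 <= t <oo) ((b t)%:R : R)%:E)%E.
Proof.
move=> bS.
have b_le m n : (m <= n)%N -> b n -> b m.
  by move=> /subnK <-; elim: (n - m)%N => //= k IHk; rewrite addSn => /bS.
have b0 k : (0 <= k)%N -> (0 <= ((b k)%:R : R)%:E)%E by rewrite lee_fin.
case: (pselect (exists t, ~~ b t)) => [hit|nohit].
  case: (ex_minnP hit) => m nbm minm.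
  transitivity ((m%:R : R)%:E); last first.
    rewrite (@nneseries_split _ _ 0 m)// add0n [X in (_ + X)%E]eseries0.
      rewrite adde0 sumEFin big_nat (eq_bigr (fun=> 1)) => [|i im].
        by rewrite -big_nat big_const_nat subn0 iter_addr addr0.
      by case: (boolP (b i)) => // /minm; move: im; lia.
    move=> i mi _; case: (boolP (b i)) => // /(b_le _ _ mi).
    by rewrite (negbTE nbm).
  apply/eqP; rewrite eq_le; apply/andP; split.
    by apply: ereal_inf_lbound; exists m.
  by apply: le_ereal_inf_tmp => _ [t nbt <-]; rewrite lee_fin ler_nat minm.
rewrite [X in ereal_inf X](_ : _ = set0); last first.
  by rewrite -subset0 => y [t nbt _]; apply: nohit; exists t.
rewrite ereal_inf0; apply/esym/eqyP => A A0.
have [n An] : exists n : nat, A <= n%:R.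
  by exists (Num.bound A); rewrite ltW// archi_boundP// ltW.
apply: le_trans (nneseries_lim_ge n _) => //; rewrite sumEFin lee_fin.
apply: le_trans An _; rewrite (eq_bigr (fun=> 1)) => [|i _].
  by rewrite big_const_nat subn0 iter_addr addr0.
by case: (boolP (b i)) => // nb; case: nohit; exists i.
Qed.

Lemma measure_sum_fibers d (Omega : measurableType d) (R : realType)
    (P : probability Omega R) (E : finType) (Y : Omega -> E) (F : set Omega) :
  discrete_measurable_fun Y -> measurable F ->
  P F = (\sum_(e : E) P (Y @^-1` [set e] `&` F))%E.
Proof.
move=> mY mF; rewrite fsbig_seq ?index_enum_uniq//.
rewrite -measure_fin_bigcup//=; last 2 first.
- by move=> e e' _ _ [w [[<- _] [<- _]]].
- by move=> e _; apply: measurableI.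
congr (P _); apply/seteqP; split=> [w Fw|w [e _ []]//].
by exists (Y w) => //=; apply: mem_index_enum.
Qed.

(** * The Markov property of the chain *)

Section DictatorChain.
Context (R : realType) (d : measure_display) (Omega : measurableType d)
  (P : probability Omega R) (N r : nat) (j : 'I_r)
  (X : nat -> Omega -> state N) (V : nat -> Omega -> 'I_N)
  (J : nat -> 'I_r -> Omega -> 'I_N)
  (hX : update_chain P (dictator j) X V J).

Lemma dictator_step (t : nat) (w : Omega) :
  X t.+1 w = copy_site (X t w) (V t w) (J t j w).
Proof.
rewrite (update_chain_step hX); apply/ffunP => i.
by rewrite !ffunE /dictator ffunE.
Qed.

(** The current state is a function of the previous state and of the new choices,
    all of which take finitely many values. *)
Lemma measurable_state (t : nat) : discrete_measurable_fun (X t).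
Proof.
elim: t => [|t IHt] B; first exact: (update_chain_measurable_init hX).
rewrite [X in measurable X](_ : _ = \bigcup_(q in
    [set q : state N * ('I_N * 'I_N) | B (copy_site q.1 q.2.1 q.2.2)])
    (X t @^-1` [set q.1] `&` (V t @^-1` [set q.2.1]
      `&` J t j @^-1` [set q.2.2]))).
  apply: fin_bigcup_measurable => [|q _]; first exact: finite_finset.
  apply: measurableI; first exact: IHt.
  apply: measurableI; first exact: (update_chain_measurable_site hX).
  exact: (update_chain_measurable_sample hX).
apply/seteqP; split=> [w|w [[x [v u]] /= Bq [/= Xx [Vv Ju]]]].
  by rewrite /= dictator_step => Bw; exists (X t w, (V t w, J t j w)).
by rewrite /= dictator_step Xx Vv Ju.
Qed.

Lemma measurable_choices (t : nat) :
  discrete_measurable_fun (fun w => (V t w, J t j w)).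
Proof.
move=> B; rewrite [X in measurable X](_ : _ = \bigcup_(q in B)
    (V t @^-1` [set q.1] `&` J t j @^-1` [set q.2])).
  apply: fin_bigcup_measurable => [|q _]; first exact: finite_finset.
  apply: measurableI; first exact: (update_chain_measurable_site hX).
  exact: (update_chain_measurable_sample hX).
apply/seteqP; split=> [w Bw|w [[v u] /= Bq [/= -> ->]]//].
by exists (V t w, J t j w).
Qed.

(** The atoms of the past: [c i] is the pair formed by the site updated at step [i]
    and the site it copies.  A total function [c] stands for its first [t]
    values, which avoids sequences of prescribed length. *)
Definition history (x0 : state N) (c : nat -> 'I_N * 'I_N) (t : nat) :
    set Omega :=
  [set w | X 0 w = x0 /\
    forall i, (i < t)%N -> V i w = (c i).1 /\ J i j w = (c i).2].

Fixpoint replay (x0 : state N) (c : nat -> 'I_N * 'I_N) (t : nat) : state N :=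
  if t is t'.+1 then copy_site (replay x0 c t') (c t').1 (c t').2 else x0.

Lemma state_on_history x0 c t w : history x0 c t w -> X t w = replay x0 c t.
Proof.
move=> [X0 hw]; elim: t hw => [//|t IHt] hw.
rewrite dictator_step IHt => [|i it]; last by apply: hw; rewrite ltnW.
by have [-> ->] := hw t (ltnSn t).
Qed.

Lemma measurable_history x0 c t : measurable (history x0 c t).
Proof.
rewrite [X in measurable X](_ : _ = X 0 @^-1` [set x0] `&`
    \bigcap_(i in `I_t) ((fun w => (V i w, J i j w)) @^-1` [set c i])).
  apply: measurableI; first exact: measurable_state.
  apply: fin_bigcap_measurable => [|i _]; first exact: finite_II.
  exact: measurable_choices.
apply/seteqP; split=> w [/= X0 hw]; split=> // i it.
  by have [/= -> ->] := hw i it; rewrite -surjective_pairing.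
by have := hw i it; rewrite /= => <-.
Qed.

(** Independence is applied to the initial state and, for each of the first [t]
    steps, the updated site and the [j]-th sample, which is the copied site. *)
Lemma probability_history x0 c t :
  P (history x0 c t)
  = (P (X 0 @^-1` [set x0]) * ((N%:R ^+ 2)^-1 ^+ t)%:E)%E.
Proof.
pose A (a : option (nat * option 'I_r)) : set Omega :=
  match a with
  | None => X 0 @^-1` [set x0]
  | Some (i, None) => V i @^-1` [set (c i).1]
  | Some (i, Some k) => J i k @^-1` [set (c i).2]
  end.
pose s :=
  [seq Some a | a <- [seq (i, o) | i <- iota 0 t, o <- [:: None; Some j]]].
have sE i o : (Some (i, o) \in s) = (i < t)%N && (o \in [:: None; Some j]).
  rewrite mem_map; last exact: Some_inj.
  apply/allpairsP/andP => [[[k q] /= [kt qo [-> ->]]]|[it oj]].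
    by move: kt; rewrite mem_iota.
  by exists (i, o); rewrite /= mem_iota it oj.
have us : uniq (None :: s).
  rewrite /= map_inj_uniq; last exact: Some_inj.
  rewrite allpairs_uniq ?iota_uniq//; last by move=> [? ?] [? ?].
  by rewrite andbT; apply/mapP => -[].
have -> : history x0 c t = \bigcap_(a in [set` None :: s]) A a.
  apply/seteqP; split=> w /=.
    move=> [X0 hw] [[i o]|] //=; rewrite inE /= sE => /andP[/hw[Vi Ji]].
    by rewrite !inE => /orP[/eqP->|/eqP->].
  move=> Aw; split=> [|i it]; first by apply: (Aw None); rewrite /= inE eqxx.
  split; first by apply: (Aw (Some (i, None))); rewrite /= inE sE it.
  by apply: (Aw (Some (i, Some j))); rewrite /= inE sE it !inE eqxx orbT.
rewrite (update_chain_independent hX)//; last first.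
  move=> [[i [k|]]|] _ /=.
  - by exists [set (c i).2].
  - by exists [set (c i).1].
  - by exists [set x0].
rewrite big_cons; congr (_ * _)%E; rewrite big_map big_allpairs.
rewrite (eq_bigr (fun=> ((N%:R ^+ 2)^-1)%:E)) => [|i _]; last first.
  rewrite !big_cons big_nil /= mule1 (update_chain_uniform_site hX).
  by rewrite (update_chain_uniform_sample hX) -EFinM -expr2 exprVn.
by rewrite prodEFin -[t in iota 0 t]subn0 prodr_const_nat subn0.
Qed.

Definition extend_choices (c : nat -> 'I_N * 'I_N) (t : nat) (q : 'I_N * 'I_N) :
  nat -> 'I_N * 'I_N := fun i => if i == t then q else c i.

Lemma replay_extend x0 c t q :
  replay x0 (extend_choices c t q) t.+1 = copy_site (replay x0 c t) q.1 q.2.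
Proof.
rewrite /= {2 3}/extend_choices eqxx; congr copy_site.
suff : forall k, (k <= t)%N ->
    replay x0 (extend_choices c t q) k = replay x0 c k.
  exact.
elim=> //= k IHk kt; rewrite IHk 1?ltnW// /extend_choices.
by rewrite (_ : k == t = false)//; apply/negbTE; rewrite neq_ltn kt.
Qed.

Lemma history_extend x0 c t q :
  history x0 (extend_choices c t q) t.+1
  = (fun w => (V t w, J t j w)) @^-1` [set q] `&` history x0 c t.
Proof.
apply/seteqP; split=> w.
  move=> [X0 hw]; split.
    have := hw t (ltnSn t); rewrite /= /extend_choices eqxx.
    by case: q {hw} => ? ? /= [-> ->].
  split=> // i it; have := hw i (ltnW it); rewrite /extend_choices.
  by rewrite (_ : i == t = false)//; apply/negbTE; rewrite neq_ltn it.
move=> [/= qE [X0 hw]]; split=> // i; rewrite ltnS leq_eqVlt /extend_choices.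
by case: eqP => [-> _|_ /= /hw//]; rewrite -qE.
Qed.

(** Induction on the number [n] of remaining steps: a past splits according to the
    next pair of choices into [N ^ 2] longer pasts of equal probability, which is
    the averaging performed by one application of the operator. *)
Lemma markov_property (b : state N -> bool) n x0 c t :
  P (history x0 c t `&` [set w | b (X (t + n) w)])
  = (P (history x0 c t)
     * (iter n (@voter_average R N) (fun y => (b y)%:R) (replay x0 c t))%:E)%E.
Proof.
elim: n c t => [|n IHn] c t.
  rewrite addn0 /=; case: (boolP (b (replay x0 c t))) => bx.
    rewrite mule1; congr (P _); apply/seteqP; split=> [w []//|w hw].
    by split=> //=; rewrite (state_on_history hw).
  rewrite mule0 [X in P X](_ : _ = set0) ?measure0// -subset0 => w [hw] /=.
  by rewrite (state_on_history hw) (negbTE bx).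
rewrite (measure_sum_fibers P (measurable_choices t)); last first.
  apply: measurableI; first exact: measurable_history.
  exact: (measurable_state (t + n.+1) [set y | b y]).
rewrite (eq_bigr (fun q => (fine (P (history x0 c t)) * (N%:R ^+ 2)^-1
    * iter n (@voter_average R N) (fun y => (b y)%:R)
        (copy_site (replay x0 c t) q.1 q.2))%:E)) => [|q _]; last first.
  rewrite setIA -history_extend addnS -addSn IHn replay_extend.
  rewrite [RHS]EFinM; congr (_ * _)%E.
  rewrite EFinM fineK ?fin_num_measure//; last exact: measurable_history.
  by rewrite !probability_history exprSr EFinM muleA.
rewrite sumEFin -mulr_sumr iterS -[P _]fineK ?fin_num_measure//; last first.
  exact: measurable_history.
rewrite -EFinM.
by rewrite /voter_average -mulrA [in LHS](mulrC _^-1) pair_bigA.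
Qed.

(** * The expected consensus time *)

(** Constant states are absorbing, so the consensus time counts the times at which
    the state is not constant. *)
Lemma consensus_time_series (w : Omega) :
  consensus_time R X w
  = (\sum_(0 <= t <oo) ((nonconstant (X t w))%:R : R)%:E)%E.
Proof.
rewrite -(@hitting_time_series _ (fun t => nonconstant (X t w))); last first.
  move=> t; apply: contraTT => /constant_stateP ct; apply/constant_stateP.
  by rewrite dictator_step; exact: copy_site_constant.
by congr (ereal_inf (_ @` _)); apply/seteqP; split=> t /constant_stateP.
Qed.

Lemma probability_nonconstant (n s : nat) : (0 < N)%N ->
  P ([set w | num_ones (X 0 w) = s] `&` [set w | nonconstant (X n w)])
  = (\sum_(x0 : state N | num_ones x0 == s)
      P (X 0 @^-1` [set x0]) * (survival R n x0)%:E)%E.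
Proof.
move=> N0; rewrite (measure_sum_fibers P (measurable_state 0)); last first.
  apply: measurableI; first exact: (measurable_state 0 [set y | num_ones y = s]).
  exact: (measurable_state n [set y | nonconstant y]).
rewrite [RHS]big_mkcond; apply: eq_bigr => x0 _.
rewrite setIA; case: eqP => [x0s|x0s]; last first.
  rewrite [X in P X](_ : _ = set0) ?measure0// -subset0.
  by move=> w [[/= Xw As] _]; apply: x0s; rewrite -Xw.
(* Before the first step the choices are arbitrary. *)
pose c (_ : nat) := (Ordinal N0, Ordinal N0).
have h0 : history x0 c 0 = X 0 @^-1` [set x0].
  by apply/seteqP; split=> [w []|w X0]//; split.
rewrite -h0 -[survival _ _ _]/(survival R n (replay x0 c 0)) -markov_property h0.
congr (P _); apply/seteqP; split=> w /=; first by move=> [[]].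
by move=> [Xw nw]; rewrite Xw.
Qed.

(** Monotone convergence exchanges the integral with the sum over time, and the
    sum over initial states is finite; for each of them the sum over time is
    [survival_series]. *)
Lemma expected_consensus_time (s : nat) : (0 < N)%N ->
  (\int[P]_(w in [set w | num_ones (X 0 w) = s]) consensus_time R X w)%E
  = (P [set w | num_ones (X 0 w) = s] * (mean_consensus_time R N s)%:E)%E.
Proof.
move=> N0; set A := [set w | _].
have mA : measurable A by exact: (measurable_state 0 [set y | num_ones y = s]).
have mn n : measurable [set w | nonconstant (X n w)].
  exact: (measurable_state n [set y | nonconstant y]).
transitivity (\int[P]_(w in A) (\sum_(0 <= n <oo)
    (\1_[set w | nonconstant (X n w)] w : R)%:E))%E.
  apply: eq_integral => w _; rewrite consensus_time_series.
  apply: eq_eseriesr => n _; rewrite indicE; congr ((nat_of_bool _)%:R%:E).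
  by apply/idP/idP; rewrite inE.
rewrite integral_nneseries//; last first.
  move=> n; apply/measurable_realfun.measurable_EFinP.
  exact: measurable_realfun.measurable_indic.
transitivity (\sum_(0 <= n <oo) \sum_(x0 : state N | num_ones x0 == s)
    P (X 0 @^-1` [set x0]) * (survival R n x0)%:E)%E.
  apply: eq_eseriesr => n _.
  by rewrite integral_indic// -probability_nonconstant// setIC.
rewrite nneseries_sum; last first.
  by move=> x0 n _; rewrite mule_ge0// lee_fin survival_ge0.
rewrite (measure_sum_fibers P (measurable_state 0) mA).
rewrite ge0_sume_distrl; last by move=> x0 _.
rewrite big_mkcond; apply: eq_bigr => x0 _; case: eqP => x0s; last first.
  have -> : X 0 @^-1` [set x0] `&` A = set0.
    by rewrite -subset0 => w [/= Xw As]; apply: x0s; rewrite -Xw.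
  by rewrite measure0 mul0e.
have -> : X 0 @^-1` [set x0] `&` A = X 0 @^-1` [set x0].
  by apply/seteqP; split=> w /= => [[]//|Xw]; rewrite /A /= Xw.
rewrite -[P _]fineK ?fin_num_measure//; last exact: measurable_state.
rewrite nneseriesZl; last by move=> n _; rewrite lee_fin survival_ge0.
have cvg_x0 := @survival_series R N x0 N0.
congr (_ * _)%E; rewrite -x0s -(cvg_lim (@Rhausdorff R) cvg_x0) -EFin_lim.
  by apply: congr_lim; apply/funext => n; rewrite sumEFin.
by apply/cvg_ex; exists (mean_consensus_time R N (num_ones x0)).
Qed.

End DictatorChain.

Theorem theorem26 (R : realType) (d : measure_display)
    (Omega : measurableType d) (P : probability Omega R)
    (N r : nat) (j : 'I_r)
    (X : nat -> Omega -> state N) (V : nat -> Omega -> 'I_N)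
    (J : nat -> 'I_r -> Omega -> 'I_N) (s : nat)
    (hN : (2 <= N)%N)
    (hX : update_chain P (dictator j) X V J)
    (hs : (1 <= s <= N - 1)%N)
    (hP : (0 < P [set w | num_ones (X 0%N w) = s])%E) :
  cond_expectation P (consensus_time R X) [set w | num_ones (X 0%N w) = s] =
  (N%:R * (N%:R - s%:R)
     * (harmonic_number R (N - 1) - harmonic_number R (N - s - 1))
   + N%:R * s%:R * (harmonic_number R (N - 1) - harmonic_number R s))%:E.
Proof.
have N0 : (0 < N)%N by apply: leq_trans hN.
have sN : (0 < s < N)%N by lia.
have mA : measurable [set w | num_ones (X 0%N w) = s].
  exact: (measurable_state hX 0 [set y | num_ones y = s]).
rewrite /cond_expectation (expected_consensus_time hX s N0).
rewrite (mean_consensus_time_interior R sN) muleC muleA.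
have PA : P [set w | num_ones (X 0%N w) = s]
    = (fine (P [set w | num_ones (X 0%N w) = s]))%:E.
  by rewrite fineK// fin_num_measure.
move: hP; rewrite PA lte_fin => p0.
by rewrite inver gt_eqF// -!EFinM mulVf ?mul1r// gt_eqF.
Qed.
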